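(* Let $w$ be a Sturmian word, let $u$ be a factor of $w$, and let $r$ be an abelian return of $u$ in $w$. Then either $r$ is a single letter, or $r=aBb$ where $a\neq b$ are letters and $B$ is a (possibly empty) bispecial factor of $w$.
   Context: A right infinite word $w=w_1w_2\cdots$ is Sturmian if for every $n\ge 0$ it has exactly $n+1$ distinct factors of length $n$ (so it is a recurrent word over a two-letter alphabet). A factor of $w$ is a finite block of consecutive letters occurring in $w$. $|u|$ is the length of a finite word $u$, and $|u|_a$ is the number of occurrences of the letter $a$ in $u$. Finite words $u,v$ are abelian equivalent, written $u\approx^{ab}v$, if $|u|_a=|v|_a$ for all letters $a$. For a recurrent infinite word $w$ and a factor $u$ of $w$, let $n_1<n_2<\cdots$ be all the integers $n_i$ such that $w_{n_i}\cdots w_{n_i+|u|-1}\approx^{ab}u$. Each word $w_{n_i}\cdots w_{n_{i+1}-1}$ is called an abelian return of $u$ in $w$. A factor $B$ of $w$ is right special if $Ba$ and $Bb$ are factors of $w$ for two distinct letters $a,b$; left special if $aB$ and $bB$ are factors of $w$ for two distinct letters $a,b$; and bispecial if it is both right special and left special. *)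

(* Defs.v *)
From mathcomp Require Import all_boot.
Set Implicit Arguments.
Unset Strict Implicit.
Unset Printing Implicit Defensive.

(* Finite words are [seq A]; right infinite words are functions
   [nat -> A], with positions numbered from 0. *)

(* The word w_i w_(i+1) ... w_(i+n-1). *)
Definition block (A : Type) (w : nat -> A) (i n : nat) : seq A :=
  [seq w k | k <- iota i n].

(* The empty word is a factor of every infinite word. *)
Definition factor (A : Type) (w : nat -> A) (u : seq A) : Prop :=
  exists i, u = block w i (size u).

(* The alphabet is arbitrary: the case n = 1 forces exactly two letters to
   occur in w. *)
Definition sturmian (A : eqType) (w : nat -> A) : Prop :=
  forall n, exists fs : seq (seq A),
    [/\ uniq fs, size fs = n.+1
      & forall v, v \in fs <-> (factor w v /\ size v = n)].

Definition abelian_equiv (A : eqType) (u v : seq A) : Prop :=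
  forall a, count_mem a u = count_mem a v.

Definition abelian_occ (A : eqType) (w : nat -> A) (u : seq A) (i : nat) : Prop :=
  abelian_equiv (block w i (size u)) u.

(* i and j are consecutive elements of the set of abelian occurrences of u. *)
Definition abelian_return (A : eqType) (w : nat -> A) (u r : seq A) : Prop :=
  exists i j,
    [/\ i < j, abelian_occ w u i, abelian_occ w u j,
        forall k, i < k < j -> ~ abelian_occ w u k
      & r = block w i (j - i)].

Definition right_special (A : eqType) (w : nat -> A) (B : seq A) : Prop :=
  factor w B /\
  exists a b, [/\ a != b, factor w (rcons B a) & factor w (rcons B b)].

Definition left_special (A : eqType) (w : nat -> A) (B : seq A) : Prop :=
  factor w B /\
  exists a b, [/\ a != b, factor w (a :: B) & factor w (b :: B)].

Definition bispecial (A : eqType) (w : nat -> A) (B : seq A) : Prop :=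
  right_special w B /\ left_special w B.

(* Main.v *)
Require Import Defs.
From mathcomp Require Import all_boot zify.

(** A Sturmian word is balanced: two factors of the same length contain almost
    the same number of each letter.  Suppose not, and take an unbalanced pair of
    minimal length n + 2.  Minimality forces it to be bvb, ava with v a
    palindrome, so v is right special and, by uniqueness, the right special
    factor of length n + 1 is av or bv.  Say it is not cv.  Reading n + 2
    consecutive factors of length n + 1 from an occurrence of cvc, one never
    meets the other extension dv, because v is a palindrome.  By complexity two
    of these factors coincide, and since none is right special, w is eventually
    periodic, a contradiction.

    Given balance, an abelian return starting with a and longer than one letter
    sees the window lose an a, keep its content, and regain an a when it ends.
    Thus the letters leaving the window spell aBb while the letters entering it
    spell bBa. *)

(** * Sliding windows of an infinite word *)

Section Blocks.
Variables (A : eqType) (w : nat -> A).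
Implicit Types (i j k n : nat) (a : A).

Lemma size_block i n : size (block w i n) = n.
Proof. by rewrite size_map size_iota. Qed.

Lemma factor_block i n : factor w (block w i n).
Proof. by exists i; rewrite size_block. Qed.

Lemma blockD i m n : block w i (m + n) = block w i m ++ block w (i + m) n.
Proof. by rewrite /block iotaD map_cat. Qed.

Lemma blockS i n : block w i n.+1 = w i :: block w i.+1 n.
Proof. by []. Qed.

Lemma blockSr i n : block w i n.+1 = rcons (block w i n) (w (i + n)).
Proof. by rewrite -addn1 blockD /= cats1. Qed.

Lemma eq_blockP i j n :
  block w i n = block w j n <-> (forall k, k < n -> w (i + k) = w (j + k)).
Proof.
split=> [e k kn|e].
  move/(congr1 (fun s => nth (w 0) s k)): e.
  by rewrite !(nth_map 0) ?size_iota // !nth_iota.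
apply: (@eq_from_nth _ (w 0)); rewrite !size_block // => k kn.
by rewrite !(nth_map 0) ?size_iota // !nth_iota // e.
Qed.

Lemma count_blockS a i n :
  count_mem a (block w i n) + (w (i + n) == a)
  = (w i == a) + count_mem a (block w i.+1 n).
Proof.
rewrite -[RHS]/(count_mem a (block w i n.+1)) blockSr -cats1 count_cat /=.
by rewrite addn0.
Qed.

End Blocks.

(** * Consequences of the factor complexity *)

Section Sturmian.
Variables (A : eqType) (w : nat -> A).
Hypothesis w_sturmian : sturmian w.
Implicit Types (i j k l n : nat) (a : A).

Lemma sturmian_blocks n : exists fs : seq (seq A),
  [/\ uniq fs, size fs = n.+1, forall i, block w i n \in fs
    & forall v, v \in fs -> exists i, v = block w i n].
Proof.
case: (w_sturmian n) => fs [un sz fsP]; exists fs; split=> // [i|v].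
  by apply/fsP; split; [exact: factor_block|exact: size_block].
by case/fsP => -[i ev] sv; exists i; rewrite ev sv.
Qed.

Lemma sturmian_letters a i j : w i != a -> w j != a -> (exists k, w k = a) -> w i = w j.
Proof.
move=> ia ja [k ka]; case: (sturmian_blocks 1) => fs [_ sz in_fs _].
apply/eqP/negPn/negP => ij.
suff: size [:: [:: w i]; [:: w j]; [:: w k]] <= size fs by rewrite sz.
apply: uniq_leq_size.
  by rewrite /= !inE !eqseq_cons !andbT negb_or ij ka ia ja.
by move=> x; rewrite !inE => /or3P[] /eqP->; apply: in_fs.
Qed.

Lemma sturmian_eq_letter i j k : (w i == w k) = (w j == w k) -> w i = w j.
Proof.
case: eqP => [->|/eqP ik]; first by move/esym/eqP=> ->.
by move/esym/negbT=> jk; apply: (sturmian_letters _ _ _ ik jk); exists k.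
Qed.

(** Otherwise each block of length [M = i + d] would recur at a start below [M], leaving at most [M]
    factors of that length. *)
Lemma sturmian_not_eventually_periodic i d :
  0 < d -> (forall m, i <= m -> w (m + d) = w m) -> False.
Proof.
move=> d0 per; set M := i + d; case: (sturmian_blocks M) => fs [un sz _ fsP].
suff: size fs <= size [seq block w x M | x <- iota 0 M].
  by rewrite sz size_map size_iota ltnn.
apply: uniq_leq_size => // v /fsP[x ->].
elim/ltn_ind: x => x IH; have [xM|Mx] := ltnP x M.
  by apply: map_f; rewrite mem_iota.
have -> : block w x M = block w (x - d) M.
  apply/eq_blockP => m _; rewrite -(per (x - d + m)); last by lia.
  by congr (w _); lia.
by apply: IH; lia.
Qed.

(** Given two distinct right special factors, deleting one extension of each from the [n + 2]
    factors of length [n + 1] leaves [n] words whose prefixes still cover all [n + 1] factors of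
    length [n]. *)
Lemma right_special_unique n i j k l :
  block w i n = block w j n -> w (i + n) != w (j + n) ->
  block w k n = block w l n -> w (k + n) != w (l + n) ->
  block w i n = block w k n.
Proof.
move=> ij nij kl nkl; apply/eqP/negPn/negP => ik.
case: (sturmian_blocks n) => fs [un sz _ fsP].
case: (sturmian_blocks n.+1) => gs [ung szg in_gs _].
have jl : block w j n.+1 != block w l n.+1.
  by rewrite !blockSr eqseq_rcons -ij -kl (negbTE ik).
have in_rem m : block w m n.+1 != block w j n.+1 -> block w m n.+1 != block w l n.+1 ->
    block w m n \in [seq take n x | x <- rem (block w j n.+1) (rem (block w l n.+1) gs)].
  move=> mj ml; apply/mapP; exists (block w m n.+1).
    by rewrite mem_rem_uniq ?rem_uniq // inE mj mem_rem_uniq // inE ml in_gs.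
  by rewrite blockSr -cats1 take_size_cat // size_block.
have : size fs <= size [seq take n x | x <- rem (block w j n.+1) (rem (block w l n.+1) gs)].
  apply: uniq_leq_size => // v /fsP[m ->].
  have [->|mi] := eqVneq (block w m n) (block w i n).
    apply: in_rem; rewrite !blockSr eqseq_rcons ?ij ?eqxx //=.
    by rewrite -ij -kl (negbTE ik).
  have [->|mk] := eqVneq (block w m n) (block w k n).
    apply: in_rem; rewrite !blockSr eqseq_rcons; last by rewrite kl eqxx.
    by rewrite -ij eq_sym (negbTE ik).
  by apply: in_rem; rewrite !blockSr eqseq_rcons -?ij -?kl ?(negbTE mi) ?(negbTE mk).
rewrite sz size_map size_rem; last by rewrite mem_rem_uniq // inE jl in_gs.
by rewrite size_rem ?in_gs // szg /= ltnn.
Qed.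

(** * Balance *)

Lemma no_palindromic_unbalance n s t :
  (forall k, k <= n.+1 -> w (s + (n.+1 - k)) = w (s + k)) ->
  w t != w s ->
  (forall k, 0 < k <= n -> w (t + k) = w (s + k)) ->
  (forall i j, block w i n.+1 = block w j n.+1 -> w (i + n.+1) != w (j + n.+1) ->
     block w i n.+1 = block w t n.+1) ->
  False.
Proof.
move=> pal ts tsv rs.
(* With [c = w s] and [d = w t], the palindrome cvc starts at [s] and dv at [t]; by [rs] only dv can
   be right special. *)
have ends : w (s + n.+1) = w s by have := pal 0 isT; rewrite subn0 addn0.
(* For dv at offset [0 < k <= n], its letter at index [n + 1 - k] is the final c of cvc; it is also
   the letter of cvc at that index, which reflects to offset [k], where d stands. *)
have avoid k : k <= n.+1 -> block w (s + k) n.+1 != block w t n.+1.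
  move=> kn; apply/eqP => /eq_blockP e; move: ts; apply/negP/negPn/eqP.
  case: (posnP k) => [k0|k0]; first by have := e 0; rewrite k0 !addn0 => <-.
  have -> : w t = w (s + k) by have := e 0; rewrite !addn0 => ->.
  rewrite -pal // -ends.
  have [->|kn1] := eqVneq k n.+1; first by rewrite subnn addn0 ends.
  rewrite -tsv; last by lia.
  by rewrite -e; [congr (w _); lia|lia].
have [k [l [kl ln bkl]]] : exists k l, [/\ k < l, l <= n.+1
    & block w (s + k) n.+1 = block w (s + l) n.+1].
  case: (sturmian_blocks n.+1) => fs [_ sz in_fs _].
  pose bs := mkseq (fun k => block w (s + k) n.+1) n.+2.
  have : ~~ uniq (block w t n.+1 :: bs).
    apply/negP => un.
    suff: size (block w t n.+1 :: bs) <= size fs by rewrite -[size (_ :: _)]/(size bs).+1 size_mkseq sz ltnn.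
    by apply: uniq_leq_size un _ => x; rewrite inE => /orP[/eqP->|/mapP[k _ ->]].
  rewrite cons_uniq negb_and negbK => /orP[/mapP[k]|].
    rewrite mem_iota => /andP[_ kn] e.
    by have := avoid k kn; rewrite e eqxx.
  move/(uniqPn [::]) => [k [l]]; rewrite /bs size_mkseq => -[kl ln].
  by rewrite !nth_mkseq //; [exists k, l|lia].
(* A block other than dv has a unique continuation, so the coincidence propagates; each new block
   repeats an earlier one and still avoids dv. *)
have inv e : block w (s + k + e) n.+1 = block w (s + l + e) n.+1 /\
    forall m, m <= l + e -> block w (s + m) n.+1 != block w t n.+1.
  elim: e => [|e [IH1 IH2]].
    by rewrite !addn0; split=> // m ml; apply: avoid; lia.
  have next : w (s + k + e + n.+1) = w (s + l + e + n.+1).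
    apply/eqP/negPn/negP => /(rs _ _ IH1)/eqP; apply/negP.
    by rewrite -addnA; apply: IH2; lia.
  have E : block w (s + k + e.+1) n.+1 = block w (s + l + e.+1) n.+1.
    rewrite !addnS; apply: (congr1 behead (_ : block w _ n.+2 = block w _ n.+2)).
    by rewrite blockSr IH1 next -blockSr.
  split=> // m; rewrite leq_eqVlt addnS ltnS => /orP[/eqP->|]; last exact: IH2.
  rewrite -addnS addnA -E -addnA; apply: IH2; lia.
apply: (@sturmian_not_eventually_periodic (s + k) (l - k)); first by lia.
move=> m km; have [/eq_blockP/(_ 0 isT) + _] := inv (m - (s + k)).
by rewrite !addn0 => e; rewrite (_ : m + _ = s + l + (m - (s + k))) -?e; [congr (w _); lia|lia].
Qed.

Lemma sturmian_balanced a p q n :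
  count_mem a (block w q n) <= (count_mem a (block w p n)).+1.
Proof.
elim/ltn_ind: n p q => N IH p q; rewrite leqNgt; apply/negP => unb.
pose c i k := count_mem a (block w i k).
have cD i k m : c i (k + m) = c i k + c (i + k) m by rewrite /c blockD count_cat.
have c0 i : c i 0 = 0 by [].
have c1 i k : c i k.+1 = c i k + (w (i + k) == a).
  by rewrite -addn1 cD /c /= addn0.
have c1l i k : c i k.+1 = (w i == a) + c i.+1 k by [].
have IHc k : k < N -> forall i j, c i k <= (c j k).+1 by move=> kN i j; apply: IH.
rewrite -/(c q N) -/(c p N) in unb.
(* Minimality caps the surplus of a prefix and of the remaining suffix at one each, while the total
   is at least two. *)
have diff k : 0 < k < N -> c q k = (c p k).+1.
  move=> /andP[k0 kN]; have := IHc k kN q p.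
  have := IHc (N - k) _ (q + k) (p + k); have := cD q k (N - k); have := cD p k (N - k).
  by rewrite subnKC; lia.
have [n En] : exists n, N = n.+2.
  by case: N unb {IH IHc diff} => [|[|n]]; rewrite ?c1 ?c0; [lia|lia|exists n].
subst N.
have diff1 : c q n.+2 = (c p n.+2).+2.
  by have := diff n.+1; rewrite !(c1 _ n.+1) in unb *; lia.
have pq k : 0 < k <= n -> (w (p + k) == a) = (w (q + k) == a).
  by move=> kn; have := diff k; have := diff k.+1; rewrite !c1; lia.
have [p0 q0] : (w p == a) = false /\ (w q == a) = true.
  by have := diff 1; rewrite !c1 !c0 !addn0; lia.
have [p1 q1] : (w (p + n.+1) == a) = false /\ (w (q + n.+1) == a) = true.
  by have := diff n.+1; move: diff1; rewrite !(c1 _ n.+1); lia.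
have qa : w q = a by apply/eqP.
have eqw i j : (w i == a) = (w j == a) -> w i = w j.
  by rewrite -qa; apply: sturmian_eq_letter.
(* By minimality, prefixes of one word against suffixes of the other; this makes v a palindrome. *)
have presuf k : 0 < k <= n.+1 -> c p k = c (p + (n.+2 - k)) k.
  move=> kn; have kN : k < n.+2 by lia.
  have := IHc k kN q (p + (n.+2 - k)); have := IHc k kN (q + (n.+2 - k)) p.
  have := diff k; have := diff (n.+2 - k).
  have := cD p (n.+2 - k) k; have := cD q (n.+2 - k) k; rewrite subnK; last by lia.
  by lia.
have palp k : k <= n.+1 -> w (p + (n.+1 - k)) = w (p + k).
  move=> kn; apply: eqw.
  have [->|k0] := posnP k; first by rewrite subn0 addn0 p0 p1.
  have [->|kn1] := eqVneq k n.+1; first by rewrite subnn addn0 p0 p1.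
  have := presuf k; have := presuf k.+1; rewrite c1 c1l -addnS subSS.
  by rewrite (_ : n.+2 - k = (n.+1 - k).+1); lia.
have palq k : k <= n.+1 -> w (q + (n.+1 - k)) = w (q + k).
  move=> kn; have [->|k0] := posnP k.
    by apply: eqw; rewrite subn0 addn0 q0 q1.
  have [->|kn1] := eqVneq k n.+1; first by apply: eqw; rewrite subnn addn0 q0 q1.
  have e m : 0 < m <= n -> w (q + m) = w (p + m) by move=> mn; apply: eqw; rewrite pq.
  by rewrite !e ?palp //; lia.
have vpq : block w p.+1 n = block w q.+1 n.
  by apply/eq_blockP => k kn; rewrite !addSnnS; apply: eqw; apply: pq; lia.
(* Dropping the first letter keeps a factor right special, and v is right special: b follows it at
   [p], a at [q]. *)
have rs_suffix i j : block w i n.+1 = block w j n.+1 -> w (i + n.+1) != w (j + n.+1) ->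
    block w i.+1 n = block w p.+1 n.
  rewrite !blockS => -[_ e] ne.
  apply: (right_special_unique n _ j.+1 _ q.+1) => //; first by rewrite !addSnnS.
  by rewrite !addSnnS; apply/eqP => E; move: p1; rewrite E q1.
have neqpq : w p != w q by rewrite qa p0.
(* The palindrome bvb at [p] excludes av; then only bv remains, which the palindrome ava at [q]
   excludes. *)
have not_rsq i j : block w i n.+1 = block w j n.+1 -> w (i + n.+1) != w (j + n.+1) ->
    block w i n.+1 <> block w q n.+1.
  move=> ij nij iq; apply: (no_palindromic_unbalance n p q) => //.
  - by rewrite eq_sym.
  - by move=> k kn; apply: eqw; rewrite pq.
  by move=> i' j' ij' nij'; rewrite -iq; apply: right_special_unique ij' nij' ij nij.
apply: (no_palindromic_unbalance n q p) => //.
  by move=> k kn; apply: eqw; rewrite pq.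
move=> i j ij nij; have si := rs_suffix _ _ ij nij.
rewrite !blockS si; congr (_ :: _); apply: eqw; rewrite p0.
apply/negP => /eqP ia; apply: (not_rsq _ _ ij nij).
by rewrite !blockS si vpq ia qa.
Qed.

(** * Abelian equivalence over two letters *)

Lemma count_other_letter i h k n : w h != w i ->
  count_mem (w h) (block w k n) + count_mem (w i) (block w k n) = n.
Proof.
move=> hi; rewrite addnC -[RHS](size_block _ w k n).
rewrite -(count_predC (pred1 (w i)) (block w k n)); congr addn.
apply: eq_in_count => _ /mapP[m _ ->] /=.
apply/eqP/idP => [->//|mi]; apply: (sturmian_letters _ _ _ mi hi).
by exists i.
Qed.

Lemma abelian_occ_count i u k :
  factor w u ->
  abelian_occ w u k <-> count_mem (w i) (block w k (size u)) = count_mem (w i) u.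
Proof.
rewrite /abelian_occ => -[m ->]; rewrite size_block; set n := size u.
split=> [|e x]; first exact.
have [->//|xi] := eqVneq x (w i).
have [xin|] := boolP ((x \in block w m n) || (x \in block w k n)).
  have [h xh] : exists h, x = w h by case/orP: xin => /mapP[h _ ->]; exists h.
  rewrite {x xin}xh in xi *.
  by have := count_other_letter _ _ k n xi; have := count_other_letter _ _ m n xi; lia.
by rewrite negb_or => /andP[/count_memPn-> /count_memPn->].
Qed.

End Sturmian.

(** * Structure of abelian returns *)

Theorem proposition2 (A : eqType) (w : nat -> A) (u r : seq A)
  (hw : sturmian w) (hu : factor w u) (hr : abelian_return w u r) :
  (exists a : A, r = [:: a]) \/
  (exists (a b : A) (B : seq A),
     [/\ a != b, bispecial w B & r = a :: rcons B b]).
Proof.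
case: hr => i [j [ij occi occj occN ->]].
have [->|ji] := eqVneq j i.+1; first by left; exists (w i); rewrite subSnn.
right; set n := size u in occi occj occN *.
pose C k := count_mem (w i) (block w k n).
have occP k := abelian_occ_count _ _ hw i _ k hu.
have CS k : C k + (w (k + n) == w i) = (w k == w i) + C k.+1 by exact: count_blockS.
have bal p q : C q <= (C p).+1 by exact: sturmian_balanced.
have Cj : C j = C i by rewrite /C (occP _).1 // (occP _).1.
have CN k : i < k < j -> C k <> C i.
  by move=> ikj e; apply: (occN k ikj); apply/occP; rewrite -/(C k) e; apply/occP.
have Ci1 : C i.+1 <> C i by apply: CN; lia.
have [Ci win] : C i = (C i.+1).+1 /\ (w (i + n) == w i) = false.
  by have := CS i; rewrite eqxx; case: eqP => _ /=; lia.
(* Balance confines [C k] to [C i - 1] and [C i], and the latter would be an abelian occurrence. *)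
have Ck k : i < k < j -> C k = C i.+1.
  by move=> ikj; have := CN k ikj; have := bal k i; have := bal i.+1 k; lia.
have [d Ed] : exists d, j = (i + d).+2 by exists (j - i.+2); lia.
have same k : k < d -> w (i.+1 + k) = w (i.+1 + k + n).
  move=> kd; apply: (sturmian_eq_letter _ _ hw _ _ i).
  by have := CS (i.+1 + k); rewrite (Ck (i.+1 + k)) ?(Ck (i.+1 + k).+1); lia.
have [wj wjn] : (w (i.+1 + d) == w i) = false /\ (w (i.+1 + d + n) == w i) = true.
  have := CS (i.+1 + d); rewrite (Ck (i.+1 + d)); last by lia.
  by rewrite addSn -Ed; lia.
exists (w i), (w (i.+1 + d)), (block w i.+1 d).
(* The word entering the window is a second occurrence of B, which supplies the other extension on
   each side. *)
have B2 : block w i.+1 d = block w (i + n).+1 d.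
  by apply/eq_blockP => k kd; rewrite same //; congr (w _); lia.
have neq : w i != w (i.+1 + d) by rewrite eq_sym wj.
have rE : block w i (j - i) = w i :: rcons (block w i.+1 d) (w (i.+1 + d)).
  by rewrite Ed -blockSr -blockS; congr block; lia.
split=> //; split; split; try exact: factor_block.
  exists (w (i.+1 + d)), (w (i.+1 + d + n)); split.
  - by rewrite (eqP wjn) wj.
  - by rewrite -blockSr; apply: factor_block.
  - rewrite B2 (_ : i.+1 + d + n = (i + n).+1 + d); last by lia.
    by rewrite -blockSr; apply: factor_block.
exists (w i), (w (i + n)); split; first by rewrite eq_sym win.
- by rewrite -blockS; apply: factor_block.
- by rewrite B2 -blockS; apply: factor_block.
Qed.
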